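(* Let $\{(V_i,\nu^i,\tau_i,\tau_i^* )\mid i\in\mathbb N\}$ be a countable family of PN spaces such that $\tau_i\ge\tau_W$ and $\tau_i^*\le\tau_{W^*}$ for all $i\in\mathbb N$. Then the $\Sigma$-product of this family, $\left(\prod_{i=1}^\infty V_i,\nu^\Sigma,\tau_W,\tau_{W^*}\right)$, where $\nu^\Sigma_{\bar p}:=\sum_{i=1}^\infty 2^{-i}\nu^i_{p_i}$ for $\bar p=(p_i)\in\prod_{i=1}^\infty V_i$, is a Menger PN space under $W$.
   Context: $\Delta^+$ is the set of distance distribution functions: nondecreasing $F:[0,+\infty]\to[0,1]$ with $F(0)=0$, $F(+\infty)=1$, left-continuous on $(0,+\infty)$, ordered pointwise and endowed with the topology of weak convergence. $\epsilon_0(x)=0$ for $x\le0$ and $1$ for $x>0$. A triangle function is a binary operation on $\Delta^+$ that is commutative, associative, nondecreasing in each argument and has $\epsilon_0$ as identity; continuity refers to weak convergence; inequalities between triangle functions are pointwise. A PN space is a quadruple $(V,\nu,\tau,\tau^* )$ where $V$ is a real linear space with null vector $\theta$, $\tau,\tau^*$ are continuous triangle functions with $\tau\le\tau^*$, and $\nu:V\to\Delta^+$, $p\mapsto\nu_p$, satisfies: (N1) $\nu_p=\epsilon_0$ iff $p=\theta$; (N2) $\nu_{-p}=\nu_p$; (N3) $\nu_{p+q}\ge\tau(\nu_p,\nu_q)$; (N4) $\nu_p\le\tau^*(\nu_{\alpha p},\nu_{(1-\alpha)p})$ for all $\alpha\in[0,1]$; for all $p,q\in V$. On $[0,1]$: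 $W(x,y)=\max\{x+y-1,0\}$ and $W^*(x,y)=\min\{x+y,1\}$; $\tau_W(F,G)(x)=\sup_{s+t=x}W(F(s),G(t))$ and $\tau_{W^*}(F,G)(x)=\inf_{s+t=x}W^*(F(s),G(t))$. A Menger PN space under $W$ is a PN space of the form $(V,\nu,\tau_W,\tau_{W^*})$. The product $\prod V_i$ has componentwise linear operations. *)

(* Defs.v *)
From HB Require Import structures.
From mathcomp Require Import all_boot all_order all_algebra.
From mathcomp Require Import all_classical all_reals all_analysis.
From mathcomp Require Import ring lra.

Set Implicit Arguments.
Unset Strict Implicit.
Unset Printing Implicit Defensive.

Import Order.TTheory GRing.Theory Num.Theory.
Import numFieldNormedType.Exports.

Local Open Scope classical_set_scope.
Local Open Scope ring_scope.

(* The extended half-line [0, +oo]. *)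
Notation nnbar R := {x : \bar R | (0 <= x)%E}.

(* The point max(x, 0) of [0, +oo]. *)
Definition nnbar_of (R : realType) (x : \bar R) : nnbar R :=
  insubd (exist _ 0%E (lexx 0%E)) x.

(* A function on [0, +oo], read as a function of a finite real argument:
   for 0 <= x it is F x, and for x < 0 it is F 0. Limits and continuity at
   points of ]0, +oo[ are expressed through it. *)
Definition on_reals (R : realType) (F : nnbar R -> R) (x : R) : R :=
  F (nnbar_of x%:E).

(* Distance distribution functions, i.e. the set Delta^+. *)
Record ddf (R : realType) := Ddf {
  ddf_fun :> nnbar R -> R ;
  ddf_itv : forall x, 0 <= ddf_fun x <= 1 ;
  ddf_homo : forall x y : nnbar R,
    (\val x <= \val y)%E -> ddf_fun x <= ddf_fun y ;
  ddf0 : ddf_fun (nnbar_of 0%E) = 0 ;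
  ddfy : ddf_fun (nnbar_of +oo%E) = 1 ;
  ddf_left_continuous : forall x : R, 0 < x ->
    on_reals ddf_fun y @[y --> x^'-] --> on_reals ddf_fun x }.

Arguments Ddf {R}.

Definition ddf_le (R : realType) (F G : ddf R) : Prop :=
  forall x : nnbar R, F x <= G x.

Section monotone.
Variable R : realType.

Lemma ddf_eq (F G : ddf R) : (forall x, F x = G x) -> F = G.
Proof.
case: F => f f1 f2 f3 f4 f5; case: G => g g1 g2 g3 g4 g5 /= fg.
have {}fg : f = g by apply/funext.
subst g; congr Ddf; exact: Prop_irrelevance.
Qed.

Lemma val_nnbar_of (x : \bar R) : \val (nnbar_of x) = Order.max x 0%E.
Proof.
by rewrite /nnbar_of val_insubd; case: leP.
Qed.

Lemma nnbar_ofK (x : \bar R) : (0 <= x)%E -> \val (nnbar_of x) = x.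
Proof. by move=> x0; rewrite val_nnbar_of max_l. Qed.

Lemma nnbar_of_val (x : nnbar R) : nnbar_of (\val x) = x.
Proof. by apply: val_inj; rewrite nnbar_ofK// (valP x). Qed.

Lemma on_reals_homo (F : nnbar R -> R) :
  (forall x y : nnbar R, (\val x <= \val y)%E -> F x <= F y) ->
  {homo on_reals F : x y / x <= y}.
Proof.
move=> Fm x y xy; apply: Fm; rewrite !val_nnbar_of.
by rewrite ge_max !le_max lexx lee_fin xy orbT.
Qed.

(* For a nondecreasing function, left-continuity amounts to approximation
   from below. *)
Lemma homo_left_continuous (f : R -> R) (x : R) : {homo f : x y / x <= y} ->
  (forall e, 0 < e -> exists2 y, y < x & f x - e < f y) ->
  f y @[y --> x^'-] --> f x.
Proof.
move=> fm H; apply/cvgrPdist_lt => e e0.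
have [y yx fy] := H _ e0.
near=> z.
have zx : z < x by near: z; apply: nbhs_left_lt.
have yz : y < z by near: z; apply: nbhs_left_gt.
have := fm _ _ (ltW zx); have := fm _ _ (ltW yz) => fyz fzx.
rewrite ger0_norm; lra.
Unshelve. all: by end_near. Qed.

Lemma left_continuous_approx (f : R -> R) (x e : R) : 0 < e ->
  f y @[y --> x^'-] --> f x ->
  exists2 y0, y0 < x & forall y, y0 < y -> y < x -> f x - e < f y.
Proof.
move=> e0 /cvgrPdist_lt /(_ _ e0) [d /= d0 H].
exists (x - d); first by lra.
move=> y xdy yx; have := H y.
rewrite /ball_/= => /(_ _ yx).
rewrite gtr0_norm ?subr_gt0// => /(_ ltac:(lra)).
by rewrite ltr_norml => /andP[_]; lra.
Qed.

Lemma homo_continuousP (f : R -> R) (c : R) : {homo f : x y / x <= y} ->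
  (forall e, 0 < e -> exists a b, [/\ a < c, c < b & f b - f a < e]) ->
  {for c, continuous f}.
Proof.
move=> fm H; apply/cvgrPdist_lt => e e0.
have [a [b [ac cb fab]]] := H _ e0.
near=> z.
have az : a < z by near: z; exact: lt_nbhsr.
have zb : z < b by near: z; exact: lt_nbhsl.
have := fm _ _ (ltW az); have := fm _ _ (ltW zb).
have := fm _ _ (ltW ac); have := fm _ _ (ltW cb).
move=> *; rewrite ltr_norml; lra.
Unshelve. all: by end_near. Qed.

Lemma homo_continuous_exists (f : R -> R) (a b : R) :
  {homo f : x y / x <= y} -> a < b ->
  exists c, [/\ a < c, c < b & {for c, continuous f}].
Proof.
move=> fm ab.
pose h (I : R * R) := (I.2 - I.1) / 5.
pose step (I : R * R) : R * R :=
  if f (I.1 + 2 * h I) - f (I.1 + h I) <= f (I.1 + 4 * h I) - f (I.1 + 3 * h I)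
  then (I.1 + h I, I.1 + 2 * h I) else (I.1 + 3 * h I, I.1 + 4 * h I).
pose u n := iter n step (a, b).
have stepP I : I.1 < I.2 -> [/\ I.1 < (step I).1, (step I).1 < (step I).2,
    (step I).2 < I.2 & f (step I).2 - f (step I).1 <= (f I.2 - f I.1) / 2].
  case: I => p q /= pq.
  have h0 : 0 < h (p, q) by rewrite /h/= divr_gt0// subr_gt0.
  have hE : q = p + 5 * h (p, q) by rewrite /h/=; field.
  move: h0 hE; set k := h (p, q) => h0 hE.
  have m1 : f p <= f (p + k) by apply: fm; lra.
  have m2 : f (p + 2 * k) <= f (p + 3 * k) by apply: fm; lra.
  have m3 : f (p + 4 * k) <= f q by apply: fm; lra.
  rewrite /step/= -/k.
  case: ifPn => /=; first by move=> ?; split; lra.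
  by rewrite -ltNge => ?; split; lra.
have ulr n : (u n).1 < (u n).2.
  by elim: n => [//|n IH]; have [] := stepP _ IH.
have uS n : u n.+1 = step (u n) by [].
have u1 n m : (n <= m)%N -> (u n).1 <= (u m).1.
  elim: m => [|m IH]; first by rewrite leqn0 => /eqP ->.
  rewrite leq_eqVlt => /predU1P[->//|/IH/le_trans]; apply.
  by have [] := stepP _ (ulr m); rewrite -uS => /ltW.
have u2 n m : (n <= m)%N -> (u m).2 <= (u n).2.
  elim: m => [|m IH]; first by rewrite leqn0 => /eqP ->.
  rewrite leq_eqVlt => /predU1P[->//|/IH]; apply: le_trans.
  by have [_ _] := stepP _ (ulr m); rewrite -uS => /ltW.
have ufg n : f (u n).2 - f (u n).1 <= (f b - f a) / 2 ^+ n.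
  elim: n => [|n IH]; first by rewrite expr0 divr1.
  have [_ _ _] := stepP _ (ulr n); rewrite -uS => /le_trans; apply.
  rewrite exprS invfM mulrA mulrAC ler_pM2r//.
pose S := [set (u n).1 | n in setT].
have Sub m : ubound S (u m).2.
  move=> _ [n _ <-].
  apply: (le_trans (u1 n (maxn n m) (leq_maxl _ _))).
  apply: (le_trans (ltW (ulr _))); exact: u2 (leq_maxr _ _).
have hS : has_sup S by split; [exists (u 0).1; exists 0 | exists (u 0).2].
pose c := sup S.
have c1 n : (u n).1 < c.
  have [+ _ _ _] := stepP _ (ulr n); rewrite -uS => /lt_le_trans; apply.
  by apply: ub_le_sup; [exact: hS.2|exists n.+1].
have c2 n : c < (u n).2.
  have [_ _ + _] := stepP _ (ulr n); rewrite -uS; apply: le_lt_trans.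
  by apply: ge_sup; [exact: hS.1|exact: Sub].
exists c; split; [exact: (c1 0)|exact: (c2 0)|].
apply: homo_continuousP => // e e0.
have : (f b - f a) / 2 ^+ n @[n --> \oo] --> (f b - f a) * 0.
  apply: cvgMr.
  have -> : (fun n => (2 ^+ n)^-1 : R) = GRing.exp 2^-1.
    by apply/funext => n; rewrite exprVn.
  by apply: cvg_expr; rewrite ger0_norm; lra.
rewrite mulr0 => /cvgrPdist_lt /(_ _ e0) [n _ /(_ n (leqnn n))].
rewrite sub0r normrN => /(le_lt_trans (ler_norm _)) lte.
exists (u n).1, (u n).2; split => //; exact: le_lt_trans (ufg n) lte.
Qed.

End monotone.

(* The topology of weak convergence: a net G converges to F if and only if
   G x converges to F x at each continuity point x of F in ]0, +oo[ (see
   [ddf_cvgP]). At the endpoints 0 and +oo all elements agree. *)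
Section weak_convergence.
Variable R : realType.

HB.instance Definition _ := gen_eqMixin (ddf R).
HB.instance Definition _ := gen_choiceMixin (ddf R).

Definition weak_nbhs (F : ddf R) : set_system (ddf R) :=
  smallest Filter [set A | exists x e : R,
    [/\ 0 < x, {for x, continuous (on_reals F)}, 0 < e &
        A = [set G : ddf R | `|on_reals F x - on_reals G x| < e]]].

#[local] Instance weak_nbhs_filter0 F : Filter (weak_nbhs F).
Proof. exact: smallest_filter_filter. Qed.

HB.instance Definition _ := hasNbhs.Build (ddf R) weak_nbhs.

Lemma weak_nbhs_dist (F : ddf R) (x e : R) :
  0 < x -> {for x, continuous (on_reals F)} -> 0 < e ->
  weak_nbhs F [set G : ddf R | `|on_reals F x - on_reals G x| < e].
Proof. by move=> x0 Fx e0; apply: sub_gen_smallest; exists x, e. Qed.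

Lemma weak_nbhs_sub (F : ddf R) (Phi : set_system (ddf R)) : Filter Phi ->
  (forall x e : R, 0 < x -> {for x, continuous (on_reals F)} -> 0 < e ->
    Phi [set G : ddf R | `|on_reals F x - on_reals G x| < e]) ->
  weak_nbhs F `<=` Phi.
Proof.
move=> PhiF H; apply: smallest_sub => // _ [x [e [x0 Fx e0 ->]]]; exact: H.
Qed.

Let weak_nbhs_singleton (F : ddf R) A : weak_nbhs F A -> A F.
Proof.
suff : weak_nbhs F `<=` [set A | A F] by apply.
apply: weak_nbhs_sub; last by move=> x e _ _ e0 /=; rewrite subrr normr0.
by split => //= P Q PQ; exact: PQ.
Qed.

Let weak_nbhs_filter (F : ddf R) : ProperFilter (weak_nbhs F).
Proof.
split; last exact: weak_nbhs_filter0.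
exact: weak_nbhs_singleton.
Qed.

Let weak_nbhs_nbhs (F : ddf R) A :
  weak_nbhs F A -> weak_nbhs F (weak_nbhs^~ A).
Proof.
suff : weak_nbhs F `<=` [set A | weak_nbhs F (weak_nbhs^~ A)] by apply.
apply: weak_nbhs_sub.
  split => /=.
  - by apply: (filterS _ filterT) => G _; apply: filterT.
  - by move=> P Q FP FQ; apply: (@filterS2 _ (weak_nbhs F) _ _ _ _ _
      FP FQ) => G; exact: filterI.
  - by move=> P Q PQ; apply: (@filterS _ (weak_nbhs F)) => G;
    exact: (@filterS _ (weak_nbhs G)).
move=> x e x0 Fx e0 /=.
have e4 : 0 < e / 4 by lra.
have Fm := on_reals_homo (@ddf_homo _ F).
have [d d0 Fd] : exists2 d, 0 < d & forall y, `|x - y| < d ->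
    `|on_reals F x - on_reals F y| < e / 4.
  move/cvgrPdist_lt : Fx => /(_ _ e4) [d /= d0 Hd].
  by exists d => // y xy; apply: Hd.
have [a [a1 a2 Fa]] : exists a, [/\ Num.max 0 (x - d) < a, a < x &
    {for a, continuous (on_reals F)}].
  by apply: homo_continuous_exists => //; rewrite gt_max; lra.
move: a1; rewrite gt_max => /andP[a0 a1].
have [b [b1 b2 Fb]] : exists b, [/\ x < b, b < x + d &
    {for b, continuous (on_reals F)}].
  by apply: homo_continuous_exists => //; lra.
have := Fd a ltac:(rewrite gtr0_norm; lra).
have := Fd b ltac:(rewrite ltr0_norm; lra).
rewrite !ltr_norml => /andP[? ?] /andP[? ?].
have b0 : 0 < b by lra.
apply: (@filterS2 _ (weak_nbhs F) _ _ _ _ _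
  (weak_nbhs_dist a0 Fa e4) (weak_nbhs_dist b0 Fb e4)) => H /=.
rewrite !ltr_norml => /andP[? ?] /andP[? ?].
have Hm := on_reals_homo (@ddf_homo _ H).
have [p [p1 p2 Hp]] : exists p, [/\ a < p, p < x &
  {for p, continuous (on_reals H)}] by exact: homo_continuous_exists.
have [q [q1 q2 Hq]] : exists q, [/\ x < q, q < b &
  {for q, continuous (on_reals H)}] by exact: homo_continuous_exists.
have p0 : 0 < p by lra.
have q0 : 0 < q by lra.
apply: (@filterS2 _ (weak_nbhs H) _ _ _ _ _
  (weak_nbhs_dist p0 Hp e4) (weak_nbhs_dist q0 Hq e4)) => K /=.
rewrite !ltr_norml => /andP[? ?] /andP[? ?].
have Km := on_reals_homo (@ddf_homo _ K).
have := Km _ _ (ltW p2); have := Km _ _ (ltW q1).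
have := Hm _ _ (ltW p1); have := Hm _ _ (ltW q2).
move=> *; apply/andP; split; lra.
Qed.

HB.instance Definition _ := Nbhs_isNbhsTopological.Build (ddf R)
  weak_nbhs_filter weak_nbhs_singleton weak_nbhs_nbhs.

Lemma ddf_cvgP (Phi : set_system (ddf R)) (F : ddf R) : Filter Phi ->
  Phi --> F <->
  forall x : R, 0 < x -> {for x, continuous (on_reals F)} ->
    on_reals G x @[G --> Phi] --> on_reals F x.
Proof.
move=> PhiF; split => [H x x0 Fx|H].
  by apply/cvgrPdist_lt => e e0; apply: H; exact: weak_nbhs_dist.
by apply: weak_nbhs_sub => x e x0 Fx; move: e; apply/cvgrPdist_lt; exact: H.
Qed.

End weak_convergence.

Section eps0.
Variable R : realType.

Definition eps0_fun (x : nnbar R) : R := (0 < \val x)%E%:R.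

Let eps0_itv x : 0 <= eps0_fun x <= 1.
Proof. by rewrite /eps0_fun; case: (_ < _)%E; rewrite /= ?lexx ler01. Qed.

Let eps0_homo (x y : nnbar R) :
  (\val x <= \val y)%E -> eps0_fun x <= eps0_fun y.
Proof.
rewrite /eps0_fun => xy; rewrite ler_nat.
have [x0|//] := boolP (0 < \val x)%E.
by rewrite (lt_le_trans x0 xy).
Qed.

Let eps00 : eps0_fun (nnbar_of 0%E) = 0.
Proof. by rewrite /eps0_fun nnbar_ofK// ltxx. Qed.

Let eps0y : eps0_fun (nnbar_of +oo%E) = 1.
Proof. by rewrite /eps0_fun nnbar_ofK ?leey// ltry. Qed.

Let eps0_left_continuous (x : R) : 0 < x ->
  on_reals eps0_fun y @[y --> x^'-] --> on_reals eps0_fun x.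
Proof.
move=> x0; apply: homo_left_continuous; first exact: on_reals_homo.
move=> e e0; exists (x / 2); first lra.
rewrite /on_reals /eps0_fun !val_nnbar_of !lt_max ltxx !orbF !lte_fin x0.
by rewrite divr_gt0//=; lra.
Qed.

Definition eps0 : ddf R :=
  Ddf eps0_fun eps0_itv eps0_homo eps00 eps0y eps0_left_continuous.

End eps0.
Arguments eps0 {R}.

Definition W (R : realType) (x y : R) : R := Num.max (x + y - 1) 0.
Definition Wstar (R : realType) (x y : R) : R := Num.min (x + y) 1.

(* All s, t in [0, +oo] with s + t = x; s = +oo or t = +oo is allowed when
   x = +oo. *)
Definition splits (R : realType) (x : nnbar R) : set (nnbar R * nnbar R) :=
  [set st | (\val st.1 + \val st.2 = \val x)%E].

Definition sup_conv (R : realType) (T : R -> R -> R) (F G : ddf R)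
    (x : nnbar R) : R :=
  sup [set T (F st.1) (G st.2) | st in splits x].

Definition inf_conv (R : realType) (T : R -> R -> R) (F G : ddf R)
    (x : nnbar R) : R :=
  inf [set T (F st.1) (G st.2) | st in splits x].

Section splits.
Variable R : realType.
Implicit Types (x y s t : nnbar R) (F G : ddf R).

Lemma val_ge0 x : (0 <= \val x)%E. Proof. exact: valP. Qed.

Lemma nnbar0 : \val (nnbar_of (0 : \bar R)) = 0%E.
Proof. exact: nnbar_ofK. Qed.

Lemma nnbary : \val (nnbar_of (+oo : \bar R)) = +oo%E.
Proof. by rewrite nnbar_ofK ?leey. Qed.

Lemma splitsE x s t : splits x (s, t) = (\val s + \val t = \val x)%E.
Proof. by []. Qed.

Lemma splits0l x : splits x (nnbar_of 0%E, x).
Proof. by rewrite splitsE nnbar0 add0e. Qed.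

Lemma splits_grow x y s t : (\val x <= \val y)%E -> splits x (s, t) ->
  exists2 s', (\val s <= \val s')%E & splits y (s', t).
Proof.
rewrite splitsE => xy st.
have [ty|tf] := eqVneq (\val t) +oo%E.
  exists s => //; move: xy; rewrite -st ty addey ?gt_eqF//; last first.
    by rewrite (lt_le_trans _ (val_ge0 s))// ltNy0.
  rewrite leye_eq splitsE => /eqP ->.
  by rewrite ty addey// gt_eqF// (lt_le_trans _ (val_ge0 s))// ltNy0.
have tfin : \val t \is a fin_num.
  by rewrite ge0_fin_numE ?val_ge0// lt_neqAle tf leey.
have sE : (\val s <= \val y - \val t)%E by rewrite leeBrDr// st.
exists (nnbar_of (\val y - \val t)%E).
  by rewrite nnbar_ofK// (le_trans (val_ge0 s)).
by rewrite splitsE nnbar_ofK ?(le_trans (val_ge0 s))// subeK.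
Qed.

Lemma splits_shrink x y s t : (\val x <= \val y)%E -> splits y (s, t) ->
  exists s' t', [/\ (\val s' <= \val s)%E, (\val t' <= \val t)%E &
    splits x (s', t')].
Proof.
rewrite splitsE => xy st.
have [xs|sx] := leP (\val x) (\val s).
  exists x, (nnbar_of 0%E); split => //; first by rewrite nnbar0 val_ge0.
  by rewrite splitsE nnbar0 adde0.
have sfin : \val s \is a fin_num.
  by rewrite ge0_fin_numE ?val_ge0// (lt_le_trans sx)// leey.
have E : (0 <= \val x - \val s)%E by rewrite sube_ge0 ?sfin// ltW.
exists s, (nnbar_of (\val x - \val s)%E); split => //.
  by rewrite nnbar_ofK// leeBlDr// addeC st.
by rewrite splitsE nnbar_ofK// addeC subeK.
Qed.

Lemma splits_fin (x : R) s t : 0 <= x -> splits (nnbar_of x%:E) (s, t) ->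
  exists a b : R, [/\ s = nnbar_of a%:E, t = nnbar_of b%:E,
    0 <= a, 0 <= b & a + b = x].
Proof.
rewrite splitsE => x0; rewrite nnbar_ofK ?lee_fin//.
move: (nnbar_of_val s) (nnbar_of_val t) (val_ge0 s) (val_ge0 t).
case: (\val s) => [a| |]//; case: (\val t) => [b| |]//.
by move=> <- <- ? ? [ab]; exists a, b.
Qed.

Lemma splits_real (a b : R) : 0 <= a -> 0 <= b ->
  splits (nnbar_of (a + b)%:E) (nnbar_of a%:E, nnbar_of b%:E).
Proof.
by move=> a0 b0; rewrite splitsE !nnbar_ofK ?lee_fin// addr_ge0.
Qed.

Lemma ddf_ge0 F x : 0 <= F x. Proof. by case/andP: (ddf_itv F x). Qed.
Lemma ddf_le1 F x : F x <= 1. Proof. by case/andP: (ddf_itv F x). Qed.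

Lemma ddf_lsc F (x e : R) : 0 < e ->
  exists2 a, a < x & on_reals F x - e < on_reals F a.
Proof.
move=> e0; have [x0|x0] := ltP 0 x.
  have [a ax H] := left_continuous_approx e0 (@ddf_left_continuous _ F _ x0).
  by exists ((a + x) / 2); [lra|apply: H; lra].
exists (x - 1); first lra.
have E z : z <= 0 -> on_reals F z = 0.
  move=> z0; rewrite -(ddf0 F) /on_reals; congr (F _); apply: val_inj.
  by rewrite !val_nnbar_of maxxx; apply: max_r; rewrite lee_fin.
by rewrite !E//; lra.
Qed.

End splits.

Section tauW.
Variables (R : realType) (F G : ddf R).

Lemma W_ge0 (u v : R) : 0 <= W u v.
Proof. by rewrite /W le_max lexx orbT. Qed.

Lemma W_homo (u u' v v' : R) : u <= u' -> v <= v' -> W u v <= W u' v'.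
Proof.
move=> uu vv; rewrite /W ge_max !le_max lexx orbT andbT.
by apply/orP; left; lra.
Qed.

Let S x := [set W (F st.1) (G st.2) | st in splits x].

Let S_ub x : ubound (S x) 1.
Proof.
move=> _ [[s t] _ <-]/=; rewrite /W ge_max ler01 andbT.
by have := ddf_le1 F s; have := ddf_le1 G t => ? ?; lra.
Qed.

Let S_sup x : has_sup (S x).
Proof.
split; last by exists 1; exact: S_ub.
exists (W (F (nnbar_of 0%E)) (G x)), (nnbar_of 0%E, x) => //.
exact: splits0l.
Qed.

Let S_le x st : splits x st -> W (F st.1) (G st.2) <= sup_conv (@W R) F G x.
Proof. by move=> xst; apply: ub_le_sup; [exact: (S_sup x).2|exists st]. Qed.

Let sup_conv_W_itv x : 0 <= sup_conv (@W R) F G x <= 1.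
Proof.
apply/andP; split; last by apply: ge_sup; [exact: (S_sup x).1|exact: S_ub].
exact: le_trans (W_ge0 _ _) (S_le (splits0l x)).
Qed.

Let sup_conv_W_homo (x y : nnbar R) :
  (\val x <= \val y)%E -> sup_conv (@W R) F G x <= sup_conv (@W R) F G y.
Proof.
move=> xy; apply: ge_sup; first exact: (S_sup x).1.
move=> _ [[s t] /(splits_grow xy)[s' ss' st'] <-]/=.
by apply: le_trans (S_le st') => /=; apply: W_homo => //; exact: ddf_homo.
Qed.

Let sup_conv_W0 : sup_conv (@W R) F G (nnbar_of 0%E) = 0.
Proof.
apply/eqP; rewrite eq_le; apply/andP; split; last first.
  by case/andP: (sup_conv_W_itv (nnbar_of 0%E)).
apply: ge_sup; first exact: (S_sup _).1.
move=> _ [[s t] /(splits_fin (lexx 0))[a [b [-> -> a0 b0 ab]]] <-]/=.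
have [-> ->] : a = 0 /\ b = 0 by split; lra.
by rewrite !ddf0 /W ge_max; apply/andP; split; lra.
Qed.

Let sup_conv_Wy : sup_conv (@W R) F G (nnbar_of +oo%E) = 1.
Proof.
apply/eqP; rewrite eq_le; apply/andP; split.
  by case/andP: (sup_conv_W_itv (nnbar_of +oo%E)).
have /S_le : splits (nnbar_of (+oo : \bar R))
    (nnbar_of (+oo : \bar R), nnbar_of (+oo : \bar R)).
  by rewrite splitsE nnbary.
by apply: le_trans; rewrite /= !ddfy /W le_max; apply/orP; left; lra.
Qed.

Let sup_conv_W_left_continuous (x : R) : 0 < x ->
  on_reals (sup_conv (@W R) F G) y @[y --> x^'-] -->
  on_reals (sup_conv (@W R) F G) x.
Proof.
move=> x0; apply: homo_left_continuous; first exact: on_reals_homo.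
move=> e e0; have e2 : 0 < e / 2 by lra.
have [_ [[s t] st <-] /=] := sup_adherent e2 (S_sup (nnbar_of x%:E)).
rewrite -/(sup_conv _ _ _ _) -/(on_reals _ _) => H.
have [a [b [sE tE a0 b0 ab]]] := splits_fin (ltW x0) st.
have [z za Fz] := ddf_lsc F a e2.
pose z' := Num.max 0 z.
have Fz' : on_reals F z <= on_reals F z'.
  apply: on_reals_homo; first exact: ddf_homo.
  by rewrite le_max lexx orbT.
have z'0 : 0 <= z' by rewrite le_max lexx.
have [a00|a00] := eqVneq a 0.
  exists (x / 2); first lra.
  have : W (F s) (G t) <= 0.
    rewrite sE a00 ddf0 /W ge_max lexx andbT.
    have := ddf_le1 G t; lra.
  have /andP[+ _] := sup_conv_W_itv (nnbar_of (x / 2)%:E).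
  rewrite -/(on_reals _ _); lra.
have z'a : z' < a by rewrite gt_max za andbT lt_neqAle eq_sym a00.
exists (z' + b); first lra.
have /S_le/= := splits_real z'0 b0.
rewrite -/(on_reals F _) -/(on_reals (sup_conv _ _ _) _).
move: H; rewrite {}sE {}tE -!/(on_reals _ _) /W => H1 H2.
have H3 : Num.max (on_reals F a + on_reals G b - 1) 0 - e / 2 <=
          Num.max (on_reals F z' + on_reals G b - 1) 0.
  rewrite lerBlDr ge_max; apply/andP; split.
    rewrite (@le_trans _ _ ((on_reals F z' + on_reals G b - 1) + e / 2))//.
      by lra.
    by rewrite lerD2r le_max lexx.
  by rewrite addr_ge0 ?(ltW e2)// le_max lexx orbT.
lra.
Qed.

Definition tauW : ddf R :=
  Ddf (sup_conv (@W R) F G) sup_conv_W_itv sup_conv_W_homo sup_conv_W0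
    sup_conv_Wy sup_conv_W_left_continuous.

End tauW.

Section tauWstar.
Variables (R : realType) (F G : ddf R).

Lemma Wstar_homo (u u' v v' : R) :
  u <= u' -> v <= v' -> Wstar u v <= Wstar u' v'.
Proof.
move=> uu vv; rewrite /Wstar le_min !ge_min lexx orbT andbT.
by apply/orP; left; lra.
Qed.

Let S x := [set Wstar (F st.1) (G st.2) | st in splits x].

Let S_lb x : lbound (S x) 0.
Proof.
move=> _ [[s t] _ <-]/=; rewrite /Wstar le_min ler01 andbT.
by rewrite addr_ge0 ?ddf_ge0.
Qed.

Let S_inf x : has_inf (S x).
Proof.
split; last by exists 0; exact: S_lb.
exists (Wstar (F (nnbar_of 0%E)) (G x)), (nnbar_of 0%E, x) => //.
exact: splits0l.
Qed.

Let S_ge x st :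
  splits x st -> inf_conv (@Wstar R) F G x <= Wstar (F st.1) (G st.2).
Proof. by move=> xst; apply: ge_inf; [exact: (S_inf x).2|exists st]. Qed.

Let inf_conv_W_itv x : 0 <= inf_conv (@Wstar R) F G x <= 1.
Proof.
apply/andP; split; first by apply: lb_le_inf; [exact: (S_inf x).1|exact: S_lb].
by apply: (le_trans (S_ge (splits0l x))); rewrite /Wstar ge_min lexx orbT.
Qed.

Let inf_conv_W_homo (x y : nnbar R) : (\val x <= \val y)%E ->
  inf_conv (@Wstar R) F G x <= inf_conv (@Wstar R) F G y.
Proof.
move=> xy; apply: lb_le_inf; first exact: (S_inf y).1.
move=> _ [[s t] /(splits_shrink xy)[s' [t' [ss tt st']]] <-]/=.
by apply: (le_trans (S_ge st')) => /=; apply: Wstar_homo; exact: ddf_homo.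
Qed.

Let inf_conv_W0 : inf_conv (@Wstar R) F G (nnbar_of 0%E) = 0.
Proof.
apply/eqP; rewrite eq_le; apply/andP; split; last first.
  by case/andP: (inf_conv_W_itv (nnbar_of 0%E)).
apply: (le_trans (S_ge (splits0l _))) => /=.
by rewrite !ddf0 /Wstar ge_min addr0 lexx.
Qed.

Let inf_conv_Wy : inf_conv (@Wstar R) F G (nnbar_of +oo%E) = 1.
Proof.
apply/eqP; rewrite eq_le; apply/andP; split.
  by case/andP: (inf_conv_W_itv (nnbar_of +oo%E)).
apply: lb_le_inf; first exact: (S_inf _).1.
move=> _ [[s t] + <-]/=; rewrite splitsE nnbary => st.
rewrite /Wstar le_min lexx andbT.
have := ddf_ge0 F s; have := ddf_ge0 G t.
have : s = nnbar_of +oo%E \/ t = nnbar_of +oo%E.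
  move: (nnbar_of_val s) (nnbar_of_val t) (val_ge0 s) (val_ge0 t) st.
  case: (\val s) => [a| |]//; case: (\val t) => [b| |]// <- <- _ _ _;
    by [left|right].
by move=> [] ->; rewrite ddfy; lra.
Qed.

Let inf_conv_W_left_continuous (x : R) : 0 < x ->
  on_reals (inf_conv (@Wstar R) F G) y @[y --> x^'-] -->
  on_reals (inf_conv (@Wstar R) F G) x.
Proof.
move=> x0; apply: homo_left_continuous; first exact: on_reals_homo.
move=> e e0; apply: contrapT => /forall2NP H.
set f := on_reals _ in H *.
have fx1 : f x <= 1 by case/andP: (inf_conv_W_itv (nnbar_of x%:E)).
have e2 : 0 < e / 2 by lra.
have e8 : 0 < e / 8 by lra.
have K y : exists s : R, 0 < y -> y < x ->
    [/\ 0 <= s, s <= y & on_reals F s + on_reals G (y - s) < f x - e / 2].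
  have [y0|?] := ltP 0 y; last by exists 0 => ?; lra.
  have [yx|?] := ltP y x; last by exists 0 => ? ?; lra.
  have [_ [[s t] st <-] /=] := inf_adherent e2 (S_inf (nnbar_of y%:E)).
  rewrite -/(inf_conv _ _ _ _) -/(on_reals _ _) -/f => Hst.
  have [a [b [sE tE a0 b0 ab]]] := splits_fin (ltW y0) st.
  exists a => _ _; split => //; first lra.
  have -> : y - a = b by lra.
  move: Hst; rewrite sE tE -!/(on_reals _ _) /Wstar.
  have [/(_ yx)//|/negP] := H y; rewrite -leNgt => fyx.
  by case: (leP (on_reals F a + on_reals G b) 1); lra.
have [s sP] := choice K.
have : (s @ x^'-) `[0, x]%classic.
  rewrite /= /fmap/=; near=> y.
  have y0 : 0 < y by near: y; exact: nbhs_left_gt.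
  have yx : y < x by near: y; exact: nbhs_left_lt.
  have [s0 sy _] := sP _ y0 yx.
  by rewrite /= in_itv/= s0/=; lra.
move=> /(segment_compact _)[p [+ pc]].
rewrite /= in_itv/= => /andP[p0 px].
have [a ap Fa] := ddf_lsc F p e8.
have [b bp Gb] := ddf_lsc G (x - p) e8.
pose d := (x - b - p) / 2.
have d0 : 0 < d by rewrite /d; lra.
have A1 : (s @ x^'-) (s @` [set y | [/\ 0 < y, x - d < y & y < x]]).
  rewrite /fmap/=; near=> y; exists y => //; split.
  - by near: y; exact: nbhs_left_gt.
  - by near: y; apply: nbhs_left_gt; rewrite /d; lra.
  - by near: y; exact: nbhs_left_lt.
have B1 : nbhs p [set z | a < z < p + d].
  near=> z; apply/andP; split.
  - by near: z; exact: lt_nbhsr.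
  - by near: z; apply: lt_nbhsl; lra.
have [_ [[y [y0 y1 y2] <-] /= /andP[sa sd]]] := pc _ _ A1 B1.
have [s0 sy] := sP _ y0 y2.
have H1 : on_reals F a <= on_reals F (s y).
  by apply: on_reals_homo; [exact: ddf_homo|exact: ltW].
have H2 : on_reals G b <= on_reals G (y - s y).
  by apply: on_reals_homo; [exact: ddf_homo|rewrite /d in y1 sd; lra].
have := splits_real p0 (_ : 0 <= x - p); rewrite subr_ge0 => /(_ px).
have -> : p + (x - p) = x by lra.
move=> /S_ge/=; rewrite -!/(on_reals _ _) -/f /Wstar => H3 H4.
have : f x <= on_reals F p + on_reals G (x - p).
  by apply: (le_trans H3); rewrite ge_min lexx.
lra.
Unshelve. all: by end_near. Qed.

Definition tauWstar : ddf R :=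
  Ddf (inf_conv (@Wstar R) F G) inf_conv_W_itv inf_conv_W_homo inf_conv_W0
    inf_conv_Wy inf_conv_W_left_continuous.

End tauWstar.

Record triangle_function (R : realType) (tau : ddf R -> ddf R -> ddf R) :
    Prop := {
  triangleC : commutative tau ;
  triangleA : associative tau ;
  triangle_homol : forall F F' G, ddf_le F F' -> ddf_le (tau F G) (tau F' G) ;
  triangle_homor : forall F G G', ddf_le G G' -> ddf_le (tau F G) (tau F G') ;
  triangle1l : left_id eps0 tau ;
  triangle1r : right_id eps0 tau }.

Definition triangle_le (R : realType) (tau tau' : ddf R -> ddf R -> ddf R) :
    Prop :=
  forall F G, ddf_le (tau F G) (tau' F G).

Record PN_space (R : realType) (V : lmodType R) (nu : V -> ddf R)
    (tau taustar : ddf R -> ddf R -> ddf R) : Prop := {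
  PN_tau : triangle_function tau ;
  PN_taustar : triangle_function taustar ;
  PN_tau_continuous : continuous (fun FG : ddf R * ddf R => tau FG.1 FG.2) ;
  PN_taustar_continuous :
    continuous (fun FG : ddf R * ddf R => taustar FG.1 FG.2) ;
  PN_tau_le : triangle_le tau taustar ;
  PN1 : forall p, nu p = eps0 <-> p = 0 ;
  PN2 : forall p, nu (- p) = nu p ;
  PN3 : forall p q, ddf_le (tau (nu p) (nu q)) (nu (p + q)) ;
  PN4 : forall (a : R) p, 0 <= a <= 1 ->
    ddf_le (nu p) (taustar (nu (a *: p)) (nu ((1 - a) *: p))) }.

Definition Menger_PN_space_W (R : realType) (V : lmodType R) (nu : V -> ddf R)
    (tau taustar : ddf R -> ddf R -> ddf R) : Prop :=
  [/\ PN_space nu tau taustar, tau = @tauW R & taustar = @tauWstar R].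

Section sigma_ddf.
Variables (R : realType) (F : nat -> ddf R).

(* Families are indexed by nat, starting from 0, so that the i-th weight is
   2^-(i+1). *)
Definition sigma_ddf_fun (x : nnbar R) : R :=
  limn [series (2 ^+ i.+1)^-1 * F i x]_i.

Let w (i : nat) : R := (2 ^+ i.+1)^-1.

Let w0 i : 0 < w i. Proof. by rewrite /w invr_gt0 exprn_gt0. Qed.

Let w_cvg : series w @ \oo --> (1 : R).
Proof.
have -> : w = geometric 2^-1 2^-1.
  by apply/funext => n; rewrite /w /geometric/= -exprVn exprS.
have E : 1 - 2^-1 = 2^-1 :> R by lra.
have := @cvg_geometric_series R 2^-1 2^-1.
by rewrite E divff ?invr_eq0//; apply; rewrite ger0_norm; lra.
Qed.

Let u_cvg x : cvgn [series w i * F i x]_i.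
Proof.
apply: (@series_le_cvg _ _ w) => [i|i|i|].
- by rewrite mulr_ge0 ?ddf_ge0// ltW.
- exact: ltW.
- by rewrite ler_piMr ?ddf_le1// ltW.
- by apply/cvg_ex; exists 1.
Qed.

Let sum_le x n : [series w i * F i x]_i n <= sigma_ddf_fun x.
Proof.
apply: nondecreasing_cvgn_le; last exact: u_cvg.
apply/nondecreasing_seqP => k; rewrite /series/= big_nat_recr//=.
by rewrite lerDl mulr_ge0 ?ddf_ge0// ltW.
Qed.

Let sigma_homo (x y : nnbar R) :
  (\val x <= \val y)%E -> sigma_ddf_fun x <= sigma_ddf_fun y.
Proof.
move=> xy; apply: ler_lim; [exact: u_cvg|exact: u_cvg|].
apply: nearW => n; rewrite /series/=; apply: ler_sum => i _.
by rewrite ler_pM2l//; exact: ddf_homo.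
Qed.

Let sigma0 : sigma_ddf_fun (nnbar_of 0%E) = 0.
Proof.
rewrite /sigma_ddf_fun (_ : series _ = cst 0) ?lim_cst//.
by apply/funext => n; rewrite /series/= big1// => i _; rewrite ddf0 mulr0.
Qed.

Let sigmay : sigma_ddf_fun (nnbar_of +oo%E) = 1.
Proof.
rewrite /sigma_ddf_fun; apply/cvg_lim => //.
rewrite (_ : [sequence _]_i = w)//.
by apply/funext => n /=; rewrite ddfy mulr1.
Qed.

Let sigma_itv x : 0 <= sigma_ddf_fun x <= 1.
Proof.
rewrite -{1}sigma0 -sigmay; apply/andP; split; apply: sigma_homo.
  by rewrite nnbar0 val_ge0.
by rewrite nnbary leey.
Qed.

Let sigma_left_continuous (x : R) : 0 < x ->
  on_reals sigma_ddf_fun y @[y --> x^'-] --> on_reals sigma_ddf_fun x.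
Proof.
move=> x0; apply: homo_left_continuous; first exact: on_reals_homo.
move=> e e0; have e2 : 0 < e / 2 by lra.
have /cvgrPdist_lt /(_ _ e2) [n _ /(_ n (leqnn n)) H] :=
  @u_cvg (nnbar_of x%:E).
rewrite -/(sigma_ddf_fun _) -/(on_reals sigma_ddf_fun _) in H.
have : (series (fun i => w i * on_reals (F i) y) n) @[y --> x^'-] -->
       series (fun i => w i * on_reals (F i) x) n.
  rewrite /series/=; elim: n {H} => [|n IH].
    by under eq_fun do rewrite big_geq//; rewrite big_geq//; exact: cvg_cst.
  under eq_fun do rewrite big_nat_recr//=.
  rewrite big_nat_recr//=; apply: cvgD => //.
  by apply: cvgMr; exact: ddf_left_continuous.
move=> /cvgrPdist_lt /(_ _ e2) H2.
near (x^'-) => y.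
exists y; first by near: y; exact: nbhs_left_lt.
have H3 := sum_le (nnbar_of y%:E) n.
have : `|series (fun i => w i * on_reals (F i) x) n -
         series (fun i => w i * on_reals (F i) y) n| < e / 2.
  by near: y.
move/(le_lt_trans (ler_norm _)); move/(le_lt_trans (ler_norm _)): H.
rewrite -/(on_reals sigma_ddf_fun _) in H3.
move: H3; rewrite /on_reals /series/=; lra.
Unshelve. all: by end_near. Qed.

Definition sigma_ddf : ddf R :=
  Ddf sigma_ddf_fun sigma_itv sigma_homo sigma0 sigmay sigma_left_continuous.

End sigma_ddf.

Section product.
Variables (R : realType) (V : nat -> lmodType R).

Definition prod_lmod := forall i, V i.

HB.instance Definition _ := Choice.copy prod_lmod (forall i, V i).

Lemma prod_ext (p q : prod_lmod) : (forall i, p i = q i) -> p = q.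
Proof. exact: functional_extensionality_dep. Qed.

Let add (p q : prod_lmod) : prod_lmod := fun i => p i + q i.
Let opp (p : prod_lmod) : prod_lmod := fun i => - p i.
Let zero : prod_lmod := fun=> 0.
Let scale (a : R) (p : prod_lmod) : prod_lmod := fun i => a *: p i.

Let addA : associative add.
Proof. by move=> p q r; apply: prod_ext => i; exact: addrA. Qed.
Let addC : commutative add.
Proof. by move=> p q; apply: prod_ext => i; exact: addrC. Qed.
Let add0 : left_id zero add.
Proof. by move=> p; apply: prod_ext => i; exact: add0r. Qed.
Let addN : left_inverse zero opp add.
Proof. by move=> p; apply: prod_ext => i; exact: addNr. Qed.

HB.instance Definition _ :=
  GRing.isZmodule.Build prod_lmod addA addC add0 addN.

Let scaleA a b p : scale a (scale b p) = scale (a * b) p.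
Proof. by apply: prod_ext => i; exact: scalerA. Qed.
Let scale1 : left_id 1 scale.
Proof. by move=> p; apply: prod_ext => i; exact: scale1r. Qed.
Let scaleDr : right_distributive scale +%R.
Proof. by move=> a p q; apply: prod_ext => i; exact: scalerDr. Qed.
Let scaleDl p : {morph scale^~ p : a b / a + b}.
Proof. by move=> a b; apply: prod_ext => i; exact: scalerDl. Qed.

HB.instance Definition _ := GRing.Zmodule_isLmodule.Build R prod_lmod
  scaleA scale1 scaleDr scaleDl.

Definition nu_sigma (nu : forall i, V i -> ddf R) (p : prod_lmod) : ddf R :=
  sigma_ddf (fun i => nu i (p i)).

End product.

(* Main.v *)
(* The inequalities a + b - 1 <= W a b and Wstar a b <= a + b are affine, so
   (N3) and (N4) survive the convex combination with weights 2^-(i+1), and (N1)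
   holds because the weights are positive and sum to 1.  For the continuity of
   tauW and tauWstar, weak convergence is turned into a one-sided Levy estimate
   F s <= F' (s + d) + e, uniform for s bounded above; both operations propagate
   such estimates, with 2 d and 2 e in place of d and e. *)
Require Import Defs.
From mathcomp Require Import all_boot all_order all_algebra.
From mathcomp Require Import all_classical all_reals all_analysis.
From mathcomp Require Import lra.

Set Implicit Arguments.
Unset Strict Implicit.
Unset Printing Implicit Defensive.

Import Order.TTheory GRing.Theory Num.Theory.
Import numFieldNormedType.Exports.

Local Open Scope classical_set_scope.
Local Open Scope ring_scope.

Section distance_distributions.
Variable R : realType.
Implicit Types (F G H : ddf R) (x s t u v : nnbar R).

Lemma nnbar_val0 x : \val x = 0%E -> x = nnbar_of 0%E.
Proof. by move=> x0; apply: val_inj; rewrite nnbar0. Qed.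

Lemma nnbarP x : [\/ x = nnbar_of 0%E, x = nnbar_of +oo%E |
  exists2 r : R, 0 < r & x = nnbar_of r%:E].
Proof.
move: (nnbar_of_val x) (val_ge0 x); case: (\val x) => [r| |]// <-.
  rewrite lee_fin le_eqVlt => /predU1P[<-|r0]; first by constructor 1.
  by constructor 3; exists r.
by constructor 2.
Qed.

Lemma on_reals_neg F (r : R) : r <= 0 -> on_reals F r = 0.
Proof.
move=> r0; rewrite -(ddf0 F) /on_reals; congr (F _); apply: val_inj.
by rewrite !val_nnbar_of maxxx; apply: max_r; rewrite lee_fin.
Qed.

Lemma on_reals_ge0 F (r : R) : 0 <= on_reals F r.
Proof. exact: ddf_ge0. Qed.

Lemma on_reals_le1 F (r : R) : on_reals F r <= 1.
Proof. exact: ddf_le1. Qed.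

Lemma on_reals_le F : {homo on_reals F : r r' / r <= r'}.
Proof. exact/on_reals_homo/ddf_homo. Qed.

Lemma eps0_pos x : (0 < \val x)%E -> eps0 x = 1 :> R.
Proof. by rewrite /= /eps0_fun => ->. Qed.

Lemma splitsC x s t : splits x (s, t) -> splits x (t, s).
Proof. by rewrite !splitsE addeC. Qed.

Lemma splitsA x s t u v : splits x (s, t) -> splits s (u, v) ->
  exists2 w, splits x (u, w) & splits w (v, t).
Proof.
rewrite !splitsE => st uv; exists (nnbar_of (\val v + \val t)%E).
  by rewrite splitsE nnbar_ofK ?adde_ge0 ?val_ge0// addeA uv.
by rewrite splitsE nnbar_ofK ?adde_ge0 ?val_ge0.
Qed.

Lemma splits_le x s t u v : splits x (s, t) -> splits x (u, v) ->
  (\val s <= \val u)%E \/ (\val t <= \val v)%E.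
Proof.
rewrite !splitsE => st uv.
have [?|us] := leP (\val s) (\val u); first by left.
have [?|vt] := leP (\val t) (\val v); first by right.
by have := lteD us vt; rewrite st uv ltxx.
Qed.

End distance_distributions.

Section triangle_W.
Variable R : realType.
Implicit Types (F G H : ddf R) (x s t u v : nnbar R).

Lemma W_leP (a b c : R) : (W a b <= c) = (a + b - 1 <= c) && (0 <= c).
Proof. by rewrite /W ge_max. Qed.

Lemma WC : commutative (@W R).
Proof. by move=> a b; rewrite /W (addrC a). Qed.

Lemma WA (a b c : R) : a <= 1 -> c <= 1 -> W (W a b) c = W a (W b c).
Proof.
move=> a1 c1; rewrite /W.
by case: (leP (a + b - 1)) => ?; case: (leP (b + c - 1)) => ?;
  do ! case: leP => ?; lra.
Qed.

Lemma tauW_ge F G x s t : splits x (s, t) -> W (F s) (G t) <= tauW F G x.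
Proof.
move=> st; apply: ub_le_sup; last by exists (s, t).
exists 1 => _ [[s' t'] _ <-]; rewrite W_leP ler01 andbT /=.
have := ddf_le1 F s'; have := ddf_le1 G t'; lra.
Qed.

Lemma tauW_le F G x (c : R) :
  (forall s t, splits x (s, t) -> W (F s) (G t) <= c) -> tauW F G x <= c.
Proof.
move=> H; apply: ge_sup; last by move=> _ [[s t] st <-]; exact: H.
by exists (W (F (nnbar_of 0%E)) (G x)), (nnbar_of 0%E, x) => //;
  exact: splits0l.
Qed.

Lemma tauWC : commutative (@tauW R).
Proof.
suff E F G : ddf_le (tauW F G) (tauW G F).
  by move=> F G; apply: ddf_eq => x; apply/eqP; rewrite eq_le !E.
by move=> x; apply: tauW_le => s t st; rewrite WC; exact/tauW_ge/splitsC.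
Qed.

Lemma tauWA : associative (@tauW R).
Proof.
have E F G H : ddf_le (tauW (tauW F G) H) (tauW F (tauW G H)).
  move=> x; apply: tauW_le => s t st; rewrite W_leP ddf_ge0 andbT.
  rewrite -lerBrDr opprK -lerBrDr; apply: tauW_le => u v uv.
  have [w xw wv] := splitsA st uv.
  have : W (F u) (W (G v) (H t)) <= tauW F (tauW G H) x.
    by apply: le_trans (tauW_ge _ _ xw); apply: W_homo => //; exact: tauW_ge.
  by rewrite -WA ?ddf_le1// W_leP => /andP[+ _]; lra.
move=> F G H; apply: ddf_eq => x; apply/eqP; rewrite eq_le E andbT.
by rewrite (tauWC F (tauW G H)) (tauWC (tauW F G)) (tauWC F G) (tauWC G H) E.
Qed.

Lemma tauW_homol F F' G : ddf_le F F' -> ddf_le (tauW F G) (tauW F' G).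
Proof.
move=> FF' x; apply: tauW_le => s t st; apply: le_trans (tauW_ge _ _ st).
exact: W_homo.
Qed.

Lemma tauW1l : left_id eps0 (@tauW R).
Proof.
move=> F; apply: ddf_eq => x; apply/eqP; rewrite eq_le; apply/andP; split.
  apply: tauW_le => s t st; rewrite W_leP ddf_ge0 andbT.
  have : F t <= F x.
    by apply: ddf_homo; rewrite -(st : _ = _) leeDr// val_ge0.
  have := ddf_le1 eps0 s; lra.
case: (nnbarP x) => [->|->|[r r0 ->]]; rewrite ?ddf0 ?ddfy//.
rewrite -/(on_reals F r) -/(on_reals (tauW eps0 F) r).
apply/ler_addgt0Pr => e e0.
have [a ar Fa] := ddf_lsc F r e0.
pose b := Num.max 0 a.
have b0 : 0 <= b by rewrite le_max lexx.
have br : b < r by rewrite gt_max r0.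
have := splits_real (_ : 0 <= r - b) b0.
rewrite subr_ge0 subrK ltW// => /(_ isT) /(tauW_ge eps0 F).
rewrite eps0_pos; last first.
  by rewrite nnbar_ofK ?lee_fin ?lte_fin ?subr_ge0 ?subr_gt0// ltW.
rewrite W_leP -/(on_reals F b) => /andP[+ _]; rewrite -/(on_reals (tauW _ _) r).
have : on_reals F a <= on_reals F b.
  by apply: on_reals_le; rewrite le_max lexx orbT.
lra.
Qed.

Lemma tauW_triangle : triangle_function (@tauW R).
Proof.
split; [exact: tauWC|exact: tauWA|exact: tauW_homol| |exact: tauW1l|].
  by move=> F G G' ?; rewrite !(tauWC F); exact: tauW_homol.
by move=> F; rewrite tauWC tauW1l.
Qed.

End triangle_W.

Section triangle_Wstar.
Variable R : realType.
Implicit Types (F G H : ddf R) (x s t u v : nnbar R).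

Lemma Wstar_geP (a b c : R) : (c <= Wstar a b) = (c <= a + b) && (c <= 1).
Proof. by rewrite /Wstar le_min. Qed.

Lemma WstarC : commutative (@Wstar R).
Proof. by move=> a b; rewrite /Wstar (addrC a). Qed.

Lemma WstarA (a b c : R) :
  0 <= a -> 0 <= c -> Wstar (Wstar a b) c = Wstar a (Wstar b c).
Proof.
move=> a0 c0; rewrite /Wstar.
by case: (leP (a + b)) => ?; case: (leP (b + c)) => ?;
  do ! case: leP => ?; lra.
Qed.

Lemma tauWstar_le F G x s t :
  splits x (s, t) -> tauWstar F G x <= Wstar (F s) (G t).
Proof.
move=> st; apply: ge_inf; last by exists (s, t).
exists 0 => _ [[s' t'] _ <-]; rewrite Wstar_geP ler01 andbT /=.
by rewrite addr_ge0 ?ddf_ge0.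
Qed.

Lemma tauWstar_ge F G x (c : R) :
  (forall s t, splits x (s, t) -> c <= Wstar (F s) (G t)) ->
  c <= tauWstar F G x.
Proof.
move=> H; apply: lb_le_inf; last by move=> _ [[s t] st <-]; exact: H.
exists (Wstar (F (nnbar_of 0%E)) (G x)), (nnbar_of 0%E, x) => //.
exact: splits0l.
Qed.

Lemma tauWstarC : commutative (@tauWstar R).
Proof.
suff E F G : ddf_le (tauWstar F G) (tauWstar G F).
  by move=> F G; apply: ddf_eq => x; apply/eqP; rewrite eq_le !E.
move=> x; apply: tauWstar_ge => s t st.
by rewrite WstarC; exact/tauWstar_le/splitsC.
Qed.

Lemma tauWstarA : associative (@tauWstar R).
Proof.
have E F G H : ddf_le (tauWstar F (tauWstar G H)) (tauWstar (tauWstar F G) H).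
  move=> x; apply: tauWstar_ge => s t st; rewrite Wstar_geP ddf_le1 andbT.
  rewrite -lerBlDr; apply: tauWstar_ge => u v uv.
  have [w xw wv] := splitsA st uv.
  have : tauWstar F (tauWstar G H) x <= Wstar (F u) (Wstar (G v) (H t)).
    apply: (le_trans (tauWstar_le _ _ xw)).
    by apply: Wstar_homo => //; exact: tauWstar_le.
  by rewrite -WstarA ?ddf_ge0// Wstar_geP => /andP[+ _]; lra.
move=> F G H; apply: ddf_eq => x; apply/eqP; rewrite eq_le E andTb.
by rewrite (tauWstarC F (tauWstar G H)) (tauWstarC (tauWstar F G))
  (tauWstarC F G) (tauWstarC G H) E.
Qed.

Lemma tauWstar_homol F F' G :
  ddf_le F F' -> ddf_le (tauWstar F G) (tauWstar F' G).
Proof.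
move=> FF' x; apply: tauWstar_ge => s t st.
by apply: (le_trans (tauWstar_le _ _ st)); exact: Wstar_homo.
Qed.

Lemma tauWstar1l : left_id eps0 (@tauWstar R).
Proof.
move=> F; apply: ddf_eq => x; apply/eqP; rewrite eq_le; apply/andP; split.
  apply: (le_trans (tauWstar_le _ _ (splits0l x))).
  by rewrite ddf0 /Wstar add0r ge_min lexx.
apply: tauWstar_ge => s t st; rewrite Wstar_geP ddf_le1 andbT.
have := val_ge0 s; rewrite le_eqVlt => /predU1P[/esym s0|s0].
  move: st; rewrite splitsE s0 add0e => /val_inj ->.
  by rewrite lerDr ddf_ge0.
rewrite eps0_pos//.
have := ddf_ge0 F t; have := ddf_le1 F x; lra.
Qed.

Lemma tauWstar_triangle : triangle_function (@tauWstar R).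
Proof.
split; [exact: tauWstarC|exact: tauWstarA|exact: tauWstar_homol| | |].
- by move=> F G G' ?; rewrite !(tauWstarC F); exact: tauWstar_homol.
- exact: tauWstar1l.
- by move=> F; rewrite tauWstarC tauWstar1l.
Qed.

Lemma tauW_le_tauWstar : triangle_le (@tauW R) (@tauWstar R).
Proof.
move=> F G x; apply: tauW_le => s t st; apply: tauWstar_ge => u v uv.
have Fs := ddf_itv F s; have Gt := ddf_itv G t.
have Fu := ddf_ge0 F u; have Gv := ddf_ge0 G v.
rewrite W_leP !Wstar_geP !ler01 addr_ge0// !andbT.
by have [/(ddf_homo F)|/(ddf_homo G)] := splits_le st uv;
  move=> ?; apply/andP; split; lra.
Qed.

End triangle_Wstar.

Section continuity.
Variable R : realType.
Implicit Types (F G H : ddf R) (d e X : R).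

Definition shift_le d e X F F' : Prop :=
  forall r : R, r <= X -> on_reals F r <= on_reals F' (r + d) + e.

Lemma shift_le_near d e X F : 0 < d -> 0 < e ->
  \forall F' \near F, shift_le d e X F F' /\ shift_le d e X F' F.
Proof.
move=> d0 e0; pose h := d / 2.
have h0 : 0 < h by rewrite /h; lra.
have grid (n : nat) : \forall F' \near F,
    shift_le d e (n%:R * h) F F' /\ shift_le d e (n%:R * h) F' F.
  elim: n => [|n IH].
    apply: filterE => F'; rewrite mul0r; split => r r0;
      by rewrite on_reals_neg// addr_ge0 ?on_reals_ge0// ltW.
  have n0 : 0 <= n%:R * h by rewrite mulr_ge0// ltW.
  rewrite -natr1 mulrDl mul1r.
  have [c [hc cd Fc]] : exists c, [/\ n%:R * h + h < c, c < n%:R * h + d &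
      {for c, continuous (on_reals F)}].
    by apply: homo_continuous_exists; [exact: on_reals_le|rewrite /h; lra].
  have c0 : 0 < c by lra.
  apply: filterS2 IH (weak_nbhs_dist c0 Fc e0) => F' [L1 L2] /=.
  rewrite ltr_norml => /andP[c1 c2].
  split => r rn; (have [|nr] := leP r (n%:R * h);
    first by [exact: L1|exact: L2]).
  - have : on_reals F r <= on_reals F c by apply: on_reals_le; lra.
    have : on_reals F' c <= on_reals F' (r + d) by apply: on_reals_le; lra.
    lra.
  - have : on_reals F' r <= on_reals F' c by apply: on_reals_le; lra.
    have : on_reals F c <= on_reals F (r + d) by apply: on_reals_le; lra.
    lra.
have [n Xn] : exists n : nat, X <= n%:R * h.
  exists (Num.truncn (`|X| / h)).+1; rewrite -ler_pdivrMr//.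
  apply: (le_trans (ler_norm _)); rewrite normrM [`|h^-1|]gtr0_norm ?invr_gt0//.
  by apply/ltW/truncnS_gt.
apply: (filterS _ (grid n)) => F' [L1 L2].
by split=> r rX; [apply: L1|apply: L2]; exact: le_trans rX Xn.
Qed.

Lemma shift_le_continuous (tau : ddf R -> ddf R -> ddf R) :
  (forall d e X F F' G G', 0 < d -> 0 < e ->
    shift_le d e X F F' -> shift_le d e X G G' ->
    shift_le (2 * d) (2 * e) X (tau F G) (tau F' G')) ->
  continuous (fun FG : ddf R * ddf R => tau FG.1 FG.2).
Proof.
move=> tauS [F G]; apply/ddf_cvgP => x x0 Hx /=.
apply/cvgrPdist_lt => e e0.
have e4 : 0 < e / 4 by lra.
have e2 : 0 < e / 2 by lra.
move/cvgrPdist_lt : Hx => /(_ _ e2) [d0 /= d00 Hd].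
pose d := d0 / 4.
have dd : 0 < d by rewrite /d; lra.
have := Hd (x + 2 * d); have := Hd (x - 2 * d); rewrite /ball_/=.
move=> /(_ ltac:(rewrite gtr0_norm /d; lra)); rewrite ltr_norml => /andP[H1 H2].
move=> /(_ ltac:(rewrite ltr0_norm /d; lra)); rewrite ltr_norml => /andP[H3 H4].
rewrite near_simpl.
exists ([set F' | shift_le d (e / 4) x F F' /\ shift_le d (e / 4) x F' F],
        [set G' | shift_le d (e / 4) x G G' /\ shift_le d (e / 4) x G' G]).
  by split; exact: shift_le_near.
move=> [F' G'] /= [[F1 F2] [G1 G2]].
have := tauS _ _ _ _ _ _ _ dd e4 F1 G1 (x - 2 * d) ltac:(lra).
have := tauS _ _ _ _ _ _ _ dd e4 F2 G2 x ltac:(lra).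
rewrite subrK => H5 H6.
rewrite ltr_norml; apply/andP; split; lra.
Qed.

Lemma tauW_continuous :
  continuous (fun FG : ddf R * ddf R => tauW FG.1 FG.2).
Proof.
apply: shift_le_continuous => d e X F F' G G' d0 e0 FF GG r rX.
have [r0|r0] := leP r 0.
  by rewrite on_reals_neg// addr_ge0 ?on_reals_ge0// mulr_ge0 ?ltW.
apply: tauW_le => s t /(splits_fin (ltW r0))[a [b [-> -> a0 b0 ab]]].
have e20 : 0 <= 2 * e by lra.
rewrite W_leP addr_ge0 ?on_reals_ge0// andbT.
have ad0 : 0 <= a + d by lra.
have bd0 : 0 <= b + d by lra.
have := tauW_ge F' G' (splits_real ad0 bd0).
have -> : a + d + (b + d) = r + 2 * d by lra.
rewrite W_leP => /andP[+ _].
have := FF a ltac:(lra); have := GG b ltac:(lra).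
rewrite /on_reals; lra.
Qed.

Lemma tauWstar_continuous :
  continuous (fun FG : ddf R * ddf R => tauWstar FG.1 FG.2).
Proof.
apply: shift_le_continuous => d e X F F' G G' d0 e0 FF GG r rX.
have [r0|r0] := leP r 0.
  by rewrite on_reals_neg// addr_ge0 ?on_reals_ge0// mulr_ge0 ?ltW.
rewrite -lerBlDr; apply: tauWstar_ge => s t.
have rd : 0 <= r + 2 * d by lra.
move=> /(splits_fin rd)[a [b [-> -> a0 b0 ab]]].
have := on_reals_le1 (tauWstar F G) r => tau1.
rewrite Wstar_geP; apply/andP; split; last by lra.
(* The mass 2 d to be removed from a + b may exceed d in one summand. *)
have [a' [b' [a'0 b'0 ab' aa bb]]] : exists a' b' : R, [/\ 0 <= a', 0 <= b',
    a' + b' = r, a' <= Num.max 0 (a - d) & b' <= Num.max 0 (b - d)].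
  have [ad|da] := leP a d.
    by exists 0, r; split; rewrite ?le_max ?lexx//; try lra;
      apply/orP; right; lra.
  have [bd|db] := leP b d.
    by exists r, 0; split; rewrite ?le_max ?lexx//; try lra;
      apply/orP; right; lra.
  by exists (a - d), (b - d); split; rewrite ?le_max ?lexx ?orbT//; lra.
have shiftP (K K' : ddf R) c c' : shift_le d e X K K' -> c' <= r ->
    c' <= Num.max 0 (c - d) -> on_reals K c' <= on_reals K' c + e.
  move=> KK c'r; rewrite le_max => /orP[c0|cd].
    by rewrite on_reals_neg// addr_ge0 ?on_reals_ge0// ltW.
  apply: (le_trans (KK _ (le_trans c'r rX))); rewrite lerD2r.
  by apply: on_reals_le; lra.
have := tauWstar_le F G (splits_real a'0 b'0).
rewrite ab' Wstar_geP => /andP[+ _].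
have := shiftP _ _ _ _ FF (_ : a' <= r) aa => /(_ ltac:(lra)).
have := shiftP _ _ _ _ GG (_ : b' <= r) bb => /(_ ltac:(lra)).
rewrite /on_reals; lra.
Qed.

End continuity.

Section sigma.
Variable R : realType.
Implicit Types (F G H : nat -> ddf R) (x s t : nnbar R).

Definition wseries (u : nat -> R) : R ^nat :=
  [series (2 ^+ i.+1)^-1 * u i]_i.

Lemma weight_gt0 (i : nat) : 0 < (2 ^+ i.+1)^-1 :> R.
Proof. by rewrite invr_gt0 exprn_gt0. Qed.

Lemma wseries_le (u v : nat -> R) (a b : R) : (forall i, u i <= v i) ->
  wseries u @ \oo --> a -> wseries v @ \oo --> b -> a <= b.
Proof.
move=> uv ua vb; apply: ler_cvg_to ua vb _; apply: nearW => n.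
by apply: ler_sum => i _; rewrite ler_pM2l ?weight_gt0.
Qed.

Lemma wseriesD (u v : nat -> R) (a b : R) :
  wseries u @ \oo --> a -> wseries v @ \oo --> b ->
  wseries (fun i => u i + v i) @ \oo --> a + b.
Proof.
move=> ua vb; rewrite (_ : wseries _ = wseries u \+ wseries v).
  exact: cvgD.
apply/funext => n; rewrite /wseries /series/= -big_split/=.
by apply: eq_bigr => i _; rewrite mulrDr.
Qed.

Lemma wseriesN (u : nat -> R) (a : R) :
  wseries u @ \oo --> a -> wseries (fun i => - u i) @ \oo --> - a.
Proof.
move=> ua; rewrite (_ : wseries _ = \- wseries u); first exact: cvgN.
apply/funext => n; rewrite /wseries /series/= -sumrN.
by apply: eq_bigr => i _; rewrite mulrN.
Qed.

Lemma wseries1 : wseries (fun=> 1) @ \oo --> (1 : R).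
Proof.
have -> : wseries (fun=> 1) = series (geometric 2^-1 2^-1).
  apply/funext => n; apply: eq_bigr => i _.
  by rewrite /geometric/= mulr1 -exprVn exprS.
have E : 1 - 2^-1 = 2^-1 :> R by lra.
have := @cvg_geometric_series R 2^-1 2^-1.
by rewrite E divff ?invr_eq0//; apply; rewrite ger0_norm; lra.
Qed.

Lemma sigma_ddf_cvg F x : wseries (fun i => F i x) @ \oo --> sigma_ddf F x.
Proof.
have : cvgn (wseries (fun=> 1 : R)) by apply/cvg_ex; exists 1; exact: wseries1.
apply: (@series_le_cvg _ (fun i => (2 ^+ i.+1)^-1 * F i x)) => i.
- by rewrite mulr_ge0 ?ddf_ge0// ltW// weight_gt0.
- by rewrite mulr_ge0 ?ler01// ltW// weight_gt0.
- by rewrite ler_pM2l ?weight_gt0// ddf_le1.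
Qed.

Lemma sigma_ddf_eps0 F : sigma_ddf F = eps0 <-> forall i, F i = eps0.
Proof.
split => [Feps i|Feps]; last first.
  apply: ddf_eq => x; have := @sigma_ddf_cvg F x.
  under [X in wseries X]funext do rewrite Feps.
  move=> /cvg_unique; apply => //=.
  rewrite /= /eps0_fun; case: (0 < _)%E; first exact: wseries1.
  rewrite (_ : wseries _ = cst 0); first exact: cvg_cst.
  by apply/funext => n; rewrite /wseries /series/= big1// => j _; rewrite mulr0.
apply: ddf_eq => x; have := val_ge0 x; rewrite le_eqVlt => /predU1P[x0|x0].
  by rewrite (nnbar_val0 (esym x0)) !ddf0.
rewrite eps0_pos//; apply/eqP; rewrite eq_le ddf_le1/=.
have := wseriesD wseries1 (wseriesN (@sigma_ddf_cvg F x)).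
rewrite Feps eps0_pos// subrr; set u := fun _ => _ => uc.
have u0 j : 0 <= (2 ^+ j.+1)^-1 * u j.
  by rewrite mulr_ge0 ?subr_ge0 ?ddf_le1// ltW// weight_gt0.
have : wseries u i.+1 <= 0.
  rewrite -(cvg_lim _ uc)//; apply: nondecreasing_cvgn_le.
    apply/nondecreasing_seqP => k.
    by rewrite /wseries /series/= big_nat_recr//= lerDl.
  by apply/cvg_ex; exists 0.
rewrite /wseries /series/= big_nat_recr//= => ui.
have : (2 ^+ i.+1)^-1 * u i <= 0.
  by apply: le_trans ui; rewrite lerDr sumr_ge0.
by rewrite pmulr_rle0 ?weight_gt0// subr_le0.
Qed.

Lemma sigma_ddf_tauW F G H : (forall i, ddf_le (tauW (F i) (G i)) (H i)) ->
  ddf_le (tauW (sigma_ddf F) (sigma_ddf G)) (sigma_ddf H).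
Proof.
move=> FGH x; apply: tauW_le => s t st; rewrite W_leP ddf_ge0 andbT.
have L := wseriesD (wseriesD (@sigma_ddf_cvg F s) (@sigma_ddf_cvg G t))
  (wseriesN wseries1).
apply: wseries_le L (@sigma_ddf_cvg H x) => i /=.
by have := le_trans (tauW_ge _ _ st) (FGH i x); rewrite W_leP => /andP[].
Qed.

Lemma sigma_ddf_tauWstar F G H :
  (forall i, ddf_le (H i) (tauWstar (F i) (G i))) ->
  ddf_le (sigma_ddf H) (tauWstar (sigma_ddf F) (sigma_ddf G)).
Proof.
move=> FGH x; apply: tauWstar_ge => s t st; rewrite Wstar_geP ddf_le1 andbT.
have L := wseriesD (@sigma_ddf_cvg F s) (@sigma_ddf_cvg G t).
apply: wseries_le (@sigma_ddf_cvg H x) L => i /=.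
have := le_trans (FGH i x) (tauWstar_le _ _ st).
by rewrite Wstar_geP => /andP[].
Qed.

End sigma.

Theorem theorem11 (R : realType) (V : nat -> lmodType R)
    (nu : forall i : nat, V i -> ddf R)
    (tau taustar : nat -> ddf R -> ddf R -> ddf R)
    (hPN : forall i : nat, PN_space (nu i) (tau i) (taustar i))
    (htau : forall i : nat, triangle_le (@tauW R) (tau i))
    (htaustar : forall i : nat, triangle_le (taustar i) (@tauWstar R)) :
  Menger_PN_space_W (nu_sigma nu : prod_lmod V -> ddf R)
    (@tauW R) (@tauWstar R).
Proof.
split => //; split.
- exact: tauW_triangle.
- exact: tauWstar_triangle.
- exact: tauW_continuous.
- exact: tauWstar_continuous.
- exact: tauW_le_tauWstar.
- move=> p; rewrite /nu_sigma sigma_ddf_eps0; split=> [p0|-> i].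
    by apply: prod_ext => i; apply/(PN1 (hPN i)).
  exact/(PN1 (hPN i)).
- move=> p; congr sigma_ddf; apply/funext => i; exact: (PN2 (hPN i)).
- move=> p q; apply: sigma_ddf_tauW => i x.
  exact: le_trans (htau i _ _ x) (PN3 (hPN i) _ _ x).
- move=> a p a01; apply: sigma_ddf_tauWstar => i x.
  exact: le_trans (PN4 (hPN i) _ a01 x) (htaustar i _ _ x).
Qed.
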